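(* Let $n \geq 2$ be an integer and let $f(x) = \sum_{j=0}^{2n} a_j x^j \in \mathbb{Z}[x]$ be monic and irreducible with $a_j = a_{2n-j}$ for all $j$. Define the degree-$n$ polynomial $$g(x) := a_n + 2\sum_{j=1}^{n} a_{n-j} T_j\!\left(\frac{x}{2}\right) \in \mathbb{Z}[x],$$ where $T_j$ is the $j$-th Chebyshev polynomial of the first kind. If $f(-1)f(1)$ is squarefree and $g(x)$ is monogenic, then $f(x)$ is monogenic.
   Context: Chebyshev polynomials of the first kind: $T_0(x)=1$, $T_1(x)=x$, $T_n(x)=2xT_{n-1}(x)-T_{n-2}(x)$ for $n\ge2$. One has $f(x)=x^n g(x+x^{-1})$. A monic irreducible polynomial $h(x)\in\mathbb{Z}[x]$ with root $\theta$ is monogenic if $\mathbb{Z}_K=\mathbb{Z}[\theta]$, where $\mathbb{Z}_K$ is the ring of integers of $K=\mathbb{Q}(\theta)$. *)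

(* Defs.v *)
From mathcomp Require Import all_boot all_order all_algebra all_field.

Set Implicit Arguments.
Unset Strict Implicit.
Unset Printing Implicit Defensive.

Import GRing.Theory.
Local Open Scope ring_scope.

Fixpoint chebyshevT (R : nzRingType) (n : nat) : {poly R} :=
  if n is m.+1 then
    if m is k.+1 then 2%:R * 'X * chebyshevT R m - chebyshevT R k else 'X
  else 1.

(* [f] of degree [2 * n] is reciprocal: f = x^n g(x + 1/x), with g below. *)
Definition chebyshev_reduction (n : nat) (f : {poly int}) : {poly rat} :=
  ((f`_n)%:~R)%:P
  + 2%:R * \sum_(1 <= j < n.+1)
      ((f`_(n - j))%:~R)%:P * (chebyshevT rat j \Po (2%:R^-1 *: 'X)).

(* In particular 0 is not squarefree, while 1 and -1 are. *)
Definition squarefreez (m : int) : Prop :=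
  forall d : int, (d ^+ 2 %| m)%Z -> d \is a GRing.unit.

(* Irreducibility is over Q, since [irreducible_poly] for coefficients in int
   refers to pseudo-division; for a monic polynomial this is the same as being
   irreducible in Z[x], by Gauss's lemma. *)
Definition irreducibleQ (h : {poly int}) : Prop :=
  irreducible_poly (map_poly intr h : {poly rat}).

(* K = Q(theta) is any extension of rat generated by a root theta of [h]; such
   a K exists ([root_field_exists] below) and is unique up to isomorphism.
   The last line says that the integral elements of K are those of Z[theta]. *)
Definition monogenic (h : {poly int}) : Prop :=
  [/\ h \is monic, irreducibleQ h &
    forall (K : fieldExtType rat) (theta : K),
      root (map_poly intr h) theta -> <<1; theta>>%VS = fullv ->
      forall x : K, integralOver (intr : int -> K) x <->
        exists q : {poly int}, x = (map_poly intr q).[theta] ].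

Lemma root_field_exists (h : {poly int}) : irreducibleQ h ->
  exists (K : fieldExtType rat) (theta : K),
    root (map_poly intr h) theta /\ <<1; theta>>%VS = fullv.
Proof.
move=> /irredp_FAdjoin[K _ [theta htheta Ktheta]]; exists K, theta; split=> //.
rewrite -map_poly_comp in htheta.
by rewrite -(eq_map_poly (f := in_alg K \o intr)) // => z; apply: (rmorph_int (in_alg K)).
Qed.

Lemma chebyshev_reduction_int (n : nat) (f : {poly int}) :
  exists g : {poly int}, map_poly intr g = chebyshev_reduction n f.
Proof.
have T2 j : exists t : {poly int}, map_poly (intr : int -> rat) t =
    2%:R * (chebyshevT rat j \Po (2%:R^-1 *: 'X)).
  suff: (exists t : {poly int}, map_poly (intr : int -> rat) t =
           2%:R * (chebyshevT rat j \Po (2%:R^-1 *: 'X)))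
     /\ (exists t : {poly int}, map_poly (intr : int -> rat) t =
           2%:R * (chebyshevT rat j.+1 \Po (2%:R^-1 *: 'X))) by case.
  have c2 : (2%:R : {poly rat}) = (2%:R)%:P by rewrite rmorph_nat.
  have XE : 2%:R * (2%:R^-1 *: 'X) = 'X :> {poly rat}.
    by rewrite c2 mul_polyC scalerA divff // scale1r.
  elim: j => [|j [[t ht] [u hu]]].
    split; first by exists 2%:R; rewrite rmorph_nat comp_polyC mulr1.
    by exists 'X; rewrite map_polyX /= comp_polyX XE.
  split; first by exists u.
  exists ('X * u - t); rewrite rmorphB rmorphM /= map_polyX hu ht.
  rewrite comp_polyB !comp_polyM comp_polyX mulrBr c2 comp_polyC -c2 XE.
  by rewrite mulrCA.
have [s hs] : exists s : {poly int}, map_poly intr s = 2%:R * \sum_(1 <= j < n.+1)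
      ((f`_(n - j))%:~R)%:P * (chebyshevT rat j \Po (2%:R^-1 *: 'X)).
  rewrite mulr_sumr; elim/big_ind: _ => [|p q [s hs] [t ht]|j _].
  - by exists 0; rewrite rmorph0.
  - by exists (s + t); rewrite rmorphD /= hs ht.
  - have [t ht] := T2 j; exists ((f`_(n - j))%:P * t).
    by rewrite rmorphM /= map_polyC /= ht mulrCA.
by exists ((f`_n)%:P + s); rewrite rmorphD /= map_polyC /= hs.
Qed.

(* Main.v *)
(* Let theta be a root of f, alpha = theta + 1/theta (a root of g) and
   D = alpha^2 - 4 = (theta - 1/theta)^2.  Write an integral x as u + v theta with
   u, v in Q(alpha); its conjugate x' = u + v/theta is also integral, hence
   (x - x')(theta - 1/theta) = v D and (x - x')^2 = v^2 D are integral elements of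
   Q(alpha), i.e. lie in Z[alpha].  So w = v D satisfies w^2 in D Z[alpha].
   Up to sign the norm of D is g(2) g(-2) = +- f(1) f(-1), which is squarefree, so
   Z[alpha]/(D) is reduced and D divides w: thus v, and then u = x - v theta, lie
   in Z[alpha], which is contained in Z[theta] as 1/theta is. *)
Require Import Defs.
From mathcomp Require Import all_boot all_order all_algebra all_field.
From mathcomp Require Import ring zify.

Set Implicit Arguments.
Unset Strict Implicit.
Unset Printing Implicit Defensive.

Import GRing.Theory.
Local Open Scope ring_scope.

(** * Squarefree integers and reducedness modulo X^2 - 4 *)

Lemma squarefreez_neq0 (m : int) : squarefreez m -> m != 0.
Proof. by move=> sqf; apply/eqP => m0; have := sqf 2; rewrite m0 dvdz0 => /(_ isT). Qed.

Lemma squarefreez_dvd (m k : int) : (k %| m)%Z -> squarefreez m -> squarefreez k.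
Proof. by move=> km sqf d dk; apply: sqf; apply: dvdz_trans km. Qed.

(** Write m = m' d and w = w' d with d the gcd. Then m' divides w'^2 d and is coprime to w', so m'
    divides d. Hence m'^2 divides m, m' is a unit, and m divides w along with d. *)
Lemma squarefreez_dvd_sqr (m w : int) :
  squarefreez m -> (m %| w ^+ 2)%Z -> (m %| w)%Z.
Proof.
move=> sqf mw; have m0 := squarefreez_neq0 sqf.
set d := gcdz m w.
have d0 : d != 0 by rewrite gcdz_eq0 (negPf m0).
have /dvdzP[m' Em] : (d %| m)%Z by apply: dvdz_gcdl.
have /dvdzP[w' Ew] : (d %| w)%Z by apply: dvdz_gcdr.
have cop : coprimez m' w'.
  have [u [v Euv]] := Bezoutz m w; apply/coprimezP; exists (u, v) => /=.
  by apply/(mulIf d0); rewrite mul1r mulrDl -!mulrA -Em -Ew.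
have m'd : (m' %| d)%Z.
  rewrite -(@Gauss_dvdzr m' (w' ^+ 2)) ?coprimezXr //.
  rewrite -(dvdz_mul2r d0) -Em.
  by have -> : w' ^+ 2 * d * d = w ^+ 2 by rewrite Ew; ring.
have /sqf um' : (m' ^+ 2 %| m)%Z by rewrite Em expr2 dvdz_mul.
suff : (m %| d)%Z by move=> /dvdz_trans; apply; apply: dvdz_gcdr.
by rewrite Em; case/orP: um' => /eqP ->; rewrite ?mul1r ?mulN1r dvdzE ?abszN dvdnn.
Qed.

Lemma dvdz_horner_sub (p : {poly int}) (a b : int) : (a - b %| p.[a] - p.[b])%Z.
Proof.
have /factor_theorem[q Eq] : root (p - (p.[b])%:P) b.
  by rewrite /root !hornerE subrr.
have -> : p.[a] - p.[b] = (p - (p.[b])%:P).[a] by rewrite !hornerE.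
by rewrite Eq !hornerE dvdz_mull.
Qed.

(* Z[x]/(g, x^2 - 4) is reduced.  Evaluating at 2 and -2 gives W(2) = a g(2) and
   W(-2) = b g(-2); since g(2) = g(-2) mod 4 and g(2) g(-2) is not divisible by 4,
   g(2) is odd, so a = b mod 4 and a, b are the values at 2, -2 of an integral P. *)
Lemma reduced_mod_X2sub4 (g W C H : {poly int}) :
  squarefreez (g.[2] * g.[-2]) ->
  W ^+ 2 = ('X^2 - 4%:P) * C + g * H ->
  exists P R : {poly int}, W = ('X^2 - 4%:P) * R + g * P.
Proof.
move=> sqf EW.
have sq2 : squarefreez g.[2] by apply: squarefreez_dvd sqf; rewrite dvdz_mulr.
have sqN2 : squarefreez g.[-2] by apply: squarefreez_dvd sqf; rewrite dvdz_mull.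
have /dvdzP[a Ea] : (g.[2] %| W.[2])%Z.
  apply: squarefreez_dvd_sqr sq2 _.
  have -> : W.[2] ^+ 2 = g.[2] * H.[2] by rewrite -horner_exp EW !hornerE; ring.
  exact: dvdz_mulr.
have /dvdzP[b Eb] : (g.[-2] %| W.[-2])%Z.
  apply: squarefreez_dvd_sqr sqN2 _.
  have -> : W.[-2] ^+ 2 = g.[-2] * H.[-2] by rewrite -horner_exp EW !hornerE; ring.
  exact: dvdz_mulr.
have /dvdzP[k Ek] := dvdz_horner_sub g 2 (-2).
have /dvdzP[l El] := dvdz_horner_sub W 2 (-2).
have gN2 : g.[-2] = g.[2] - k * 4 by rewrite -[LHS](subKr g.[2]) Ek; ring.
have cop : coprimez 4 g.[2].
  rewrite coprimezE -[`|4|%N]/(2 ^ 2)%N coprimeXl // coprime2n.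
  apply/negPn/negP; rewrite -dvdn2 => /(@dvdzP 2 g.[2])[u Eu].
  suff /sqf : (2 ^+ 2 %| g.[2] * g.[-2])%Z by [].
  by apply/dvdzP; exists (u * (u - 2 * k)); rewrite gN2 Eu; ring.
have /dvdzP[c Ec] : (4 %| a - b)%Z.
  rewrite -(Gauss_dvdzr _ cop); apply/dvdzP; exists (l - k * b).
  have -> : g.[2] * (a - b) = a * g.[2] - b * g.[-2] - k * b * 4 by rewrite gN2; ring.
  by rewrite -Ea -Eb El; ring.
(* This linear polynomial takes the value b at -2 and b + 4c = a at 2. Subtracting its product with
   [g] from [W] therefore leaves a polynomial vanishing at both points. *)
exists (b%:P + c%:P * ('X + 2%:P)).
have /factor_theorem[q Eq] : root (W - g * (b%:P + c%:P * ('X + 2%:P))) (-2).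
  by rewrite /root !hornerE Eb; apply/eqP; ring.
have : root (W - g * (b%:P + c%:P * ('X + 2%:P))) 2.
  rewrite /root !hornerE Ea; apply/eqP.
  have -> : a = b + c * 4 by rewrite -Ec; ring.
  ring.
rewrite Eq rootM root_XsubC orbF => /factor_theorem[R ER].
exists R; apply/eqP; rewrite -subr_eq Eq ER; apply/eqP.
have -> : (4%:P : {poly int}) = 2%:P * 2%:P by rewrite -polyCM.
by rewrite polyCN; ring.
Qed.

(** * Transfer between roots of an irreducible polynomial *)

Lemma irreducible_dvdp_root (F L : fieldType) (h : {rmorphism F -> L})
    (p q : {poly F}) (x : L) :
  irreducible_poly p -> root (map_poly h p) x -> root (map_poly h q) x -> p %| q.
Proof.
move=> irr px qx; apply/negPn/negP; rewrite -irreducible_poly_coprime //.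
rewrite -(coprimep_map h) => /coprimep_root/(_ px).
by rewrite -rootE qx.
Qed.

Lemma map_in_alg_intr (K : fieldExtType rat) (p : {poly int}) :
  map_poly (in_alg K) (map_poly intr p) = map_poly intr p.
Proof.
rewrite -map_poly_comp; apply: eq_map_poly => z /=.
exact: (rmorph_int (in_alg K)).
Qed.

(** If a monic integer polynomial m kills U(x), then p divides m(U), so m kills U(y) as well. The
    two roots may lie in different fields. *)
Lemma integralOver_conj (K K' : fieldExtType rat) (p U : {poly rat}) (x : K) (y : K') :
  irreducible_poly p ->
  root (map_poly (in_alg K) p) x -> root (map_poly (in_alg K') p) y ->
  integralOver (intr : int -> K) (map_poly (in_alg K) U).[x] ->
  integralOver (intr : int -> K') (map_poly (in_alg K') U).[y].
Proof.
move=> irr px py [m mon_m mU]; exists m => //.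
have: p %| map_poly intr m \Po U.
  apply: (irreducible_dvdp_root irr px).
  by rewrite map_comp_poly /root horner_comp map_in_alg_intr.
move=> /dvdpP[q Eq].
have : root (map_poly (in_alg K') (map_poly intr m \Po U)) y.
  by rewrite Eq rmorphM rootM py orbT.
by rewrite map_comp_poly /root horner_comp map_in_alg_intr.
Qed.

(** Here [x] may generate a proper subfield of [K], whereas [monogenic] speaks of fields generated
    by a root. The element is moved to such a field, written there as an integer polynomial in the
    root, and the equality is moved back as a divisibility by [g] over the rationals. *)
Lemma monogenic_integral (g : {poly int}) (K : fieldExtType rat) (x : K) (U : {poly rat}) :
  monogenic g -> root (map_poly intr g) x ->
  integralOver (intr : int -> K) (map_poly (in_alg K) U).[x] ->
  exists q : {poly int}, (map_poly (in_alg K) U).[x] = (map_poly intr q).[x].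
Proof.
move=> [mon_g irr mono] gx iU.
have [K' [y [gy genK']]] := root_field_exists irr.
have gx' : root (map_poly (in_alg K) (map_poly intr g)) x by rewrite map_in_alg_intr.
have gy' : root (map_poly (in_alg K') (map_poly intr g)) y by rewrite map_in_alg_intr.
have /(mono _ _ gy genK')[q Eq] := integralOver_conj irr gx' gy' iU.
exists q; apply/eqP; rewrite -subr_eq0 -map_in_alg_intr -hornerN -hornerD -rmorphB -rootE.
have /dvdpP[s ->] : map_poly intr g %| U - map_poly intr q.
  apply: (irreducible_dvdp_root irr gy').
  by rewrite /root rmorphB !hornerE /= map_in_alg_intr Eq subrr.
by rewrite rmorphM rootM gx' orbT.
Qed.

(** As [g] is monic, division with remainder works over the integers. The remainder vanishes at [x],
    so [g] divides it over the rationals, and its size forces it to be 0. *)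
Lemma monic_root_dvd (g p : {poly int}) (K : fieldExtType rat) (x : K) :
  g \is monic -> irreducibleQ g -> root (map_poly intr g) x ->
  root (map_poly intr p) x -> exists q, p = g * q.
Proof.
move=> mon_g irr gx px.
have Ep := Pdiv.RingMonic.rdivp_eq mon_g p.
set r := Pdiv.Ring.rmodp p g in Ep.
suff r0 : r = 0 by exists (Pdiv.Ring.rdivp p g); rewrite {1}Ep r0 addr0 mulrC.
have size_r : (size r < size g)%N by rewrite Pdiv.Ring.ltn_rmodpN0 ?monic_neq0.
have sizeQ (s : {poly int}) : size (map_poly (intr : int -> rat) s) = size s.
  by rewrite size_map_inj_poly //; apply: intr_inj.
apply/eqP; rewrite -size_poly_eq0 -sizeQ size_poly_eq0.
apply: contraTT size_r => rn0; rewrite -leqNgt -!sizeQ dvdp_leq //.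
apply: (irreducible_dvdp_root irr (x := x) (h := in_alg K)); rewrite map_in_alg_intr //.
have -> : r = p - Pdiv.Ring.rdivp p g * g by rewrite [X in X - _]Ep addrC addKr.
by rewrite /root rmorphB rmorphM !hornerE (rootP px) (rootP gx) mulr0 subrr.
Qed.

(** * The substitution y + 1/y *)

Lemma chebyshevT_add_inv (F : fieldType) (h : {rmorphism rat -> F}) (y : F) (j : nat) :
  y != 0 ->
  2 * (map_poly h (chebyshevT rat j \Po (2%:R^-1 *: 'X))).[y + y^-1] = y ^+ j + y^-1 ^+ j.
Proof.
move=> y0.
have h2 : 2 != 0 :> F by rewrite -(rmorph_nat h) fmorph_eq0.
pose t j := (map_poly h (chebyshevT rat j \Po (2%:R^-1 *: 'X))).[y + y^-1].
have t1 : 2 * t 1%N = y + y^-1.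
  rewrite /t /= comp_polyX map_polyZ /= map_polyX !hornerE /= fmorphV rmorph_nat.
  by rewrite divff ?mul1r.
(* The powers sum y^j + y^-j obeys this same recurrence. *)
have tS i : t i.+2 = (y + y^-1) * t i.+1 - t i.
  transitivity (2 * t 1%N * t i.+1 - t i); last by rewrite t1.
  rewrite /t [chebyshevT _ i.+2]/= comp_polyB !comp_polyM rmorphB !rmorphM /=.
  rewrite -polyC_natr comp_polyC map_polyC /=.
  by rewrite hornerD hornerN !hornerM hornerC rmorph_nat.
suff: 2 * t j = y ^+ j + y^-1 ^+ j /\ 2 * t j.+1 = y ^+ j.+1 + y^-1 ^+ j.+1 by case.
elim: j => [|j [IH0 IH1]]; first by rewrite t1 /t /= comp_polyC map_polyC /= hornerC rmorph1 mulr1.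
split => //; rewrite tS mulrBr mulrCA IH0 IH1 !exprS.
by field.
Qed.

Lemma big_nat_fold (V : nmodType) (F : nat -> V) (n : nat) :
  \sum_(0 <= i < (2 * n).+1) F i = F n + \sum_(1 <= j < n.+1) (F (n - j)%N + F (n + j)%N).
Proof.
rewrite (@big_cat_nat _ _ _ n) /=; [|lia..].
rewrite [X in _ + X]big_nat_recl; last by lia.
rewrite addrCA; congr (_ + _); rewrite big_split /=; congr (_ + _).
  by rewrite big_nat_rev big_add1 /=; apply: eq_big_nat => i ?; congr F; lia.
rewrite big_add1 /= -{1}[n]add0n big_addn.
have -> : ((2 * n) - n)%N = n by lia.
by apply: eq_bigr => i _; congr F; lia.
Qed.

(** The terms of index n - j and n + j share their coefficient, and y^(n-j) + y^(n+j) = y^n (y^j +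
    y^-j). *)
Lemma chebyshev_reductionE (F : fieldType) (h : {rmorphism rat -> F}) (n : nat)
    (f : {poly int}) (y : F) :
  (size f <= (2 * n).+1)%N -> (forall j : nat, (j <= 2 * n)%N -> f`_j = f`_(2 * n - j)) ->
  y != 0 ->
  (map_poly intr f).[y] = y ^+ n * (map_poly h (chebyshev_reduction n f)).[y + y^-1].
Proof.
move=> size_f pal y0.
rewrite (horner_coef_wide _ (leq_trans (size_poly _ _) size_f)).
rewrite (eq_bigr (fun i : 'I__ => (f`_i)%:~R * y ^+ i)); last by move=> i _; rewrite coef_map.
rewrite -(big_mkord predT (fun i => (f`_i)%:~R * y ^+ i)) big_nat_fold.
rewrite /chebyshev_reduction rmorphD rmorphM /= map_polyC !hornerE /= rmorph_int.
rewrite mulrDr; congr (_ + _); first by rewrite mulrC.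
rewrite rmorph_nat -polyC_natr hornerC rmorph_sum horner_sum mulrCA !mulr_sumr.
apply: eq_big_nat => j /andP[j0 jn].
rewrite rmorphM /= map_polyC hornerM hornerC /= rmorph_int.
rewrite [RHS]mulrCA.
transitivity (y ^+ n * (f`_(n - j))%:~R * (y ^+ j + y^-1 ^+ j)); last first.
  by rewrite -(chebyshevT_add_inv h j y0); ring.
have -> : f`_(n + j) = f`_(n - j) by rewrite pal; [congr (_ `_ _)|]; lia.
rewrite -mulrDr mulrAC mulrC; congr (_ * _).
rewrite exprD mulrDr addrC; congr (_ + _).
by rewrite -{2}(subnK (ltnSE jn)) exprD exprVn mulfK // expf_neq0.
Qed.

(** Powers of y are reduced by y^2 = (y + z) y - 1. The polynomials [U] and [V] are chosen before y
    and z, so they also serve for the swapped pair. *)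
Lemma horner_decomp_add_inv (R : nzRingType) (F : comNzRingType)
    (h : {rmorphism R -> F}) (p : {poly R}) :
  exists U V : {poly R}, forall y z : F, y * z = 1 ->
    (map_poly h p).[y] = (map_poly h U).[y + z] + (map_poly h V).[y + z] * y.
Proof.
elim/poly_ind: p => [|p c [U [V IH]]].
  by exists 0, 0 => y z _; rewrite !rmorph0 !horner0 mul0r addr0.
exists (c%:P - V), (U + V * 'X) => y z yz.
rewrite !rmorphD rmorphN !rmorphM /= !map_polyC map_polyX !hornerE /= (IH y z yz).
apply/eqP; rewrite -subr_eq0; apply/eqP.
by transitivity ((map_poly h V).[y + z] * (1 - y * z)); [ring | rewrite yz subrr mulr0].
Qed.

Theorem theorem1p5 (n : nat) (f g : {poly int})
  (n_ge2 : (2 <= n)%N)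
  (f_size : size f = (2 * n).+1)
  (f_monic : f \is monic)
  (f_irr : irreducibleQ f)
  (f_pal : forall j : nat, (j <= 2 * n)%N -> f`_j = f`_(2 * n - j))
  (g_def : map_poly intr g = chebyshev_reduction n f)
  (f_sqfree : squarefreez (f.[-1] * f.[1]))
  (g_monogenic : monogenic g) :
  monogenic f.
Proof.
have [g_monic g_irr _] := g_monogenic.
have f0 : f`_0 = 1.
  by rewrite f_pal // subn0; move/monicP: f_monic; rewrite lead_coefE f_size.
split=> // K theta ftheta genK x.
have itheta : integralOver (intr : int -> K) theta by exists f.
split; last first.
  case=> q ->; apply: integral_horner => // _ /(nthP 0)[i _ <-].
  by rewrite coef_map; apply: integral_id.
have fE y : y != 0 :> K ->
    (map_poly intr f).[y] = y ^+ n * (map_poly intr g).[y + y^-1].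
  rewrite -(map_in_alg_intr K g) g_def; apply: chebyshev_reductionE => //.
  by rewrite f_size.
(* Since f(0) = 1, the equation f(theta) = 0 exhibits 1/theta as - fq(theta), an element of
   Z[theta]. *)
pose fq := drop_poly 1 f.
have fqE : f = 1 + fq * 'X.
  rewrite -[LHS](poly_take_drop 1) expr1; congr (_ + _).
  by apply/polyP => i; rewrite coef_take_poly coef1 ltnS leqn0; case: eqP => [->|].
have theta_inv : theta * (map_poly intr (- fq)).[theta] = 1.
  move/rootP: ftheta; rewrite fqE rmorphD rmorphM rmorph1 rmorphN /= map_polyX !hornerE /=.
  by move=> /(canRL (addrK _)); rewrite sub0r mulrN mulrC => <-.
set theta' := (map_poly intr (- fq)).[theta] in theta_inv.
have theta0 : theta != 0.
  by apply: contra_eq_neq theta_inv => ->; rewrite mul0r eq_sym oner_eq0.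
have theta'E : theta' = theta^-1 by rewrite -[LHS](mulKf theta0) theta_inv mulr1.
pose alpha := theta + theta'.
have galpha : root (map_poly intr g) alpha.
  by move: ftheta; rewrite /root fE // -theta'E mulf_eq0 expf_eq0 (negPf theta0) andbF.
have ftheta' : root (map_poly intr f) theta'.
  have t0 : theta' != 0 by rewrite theta'E invr_eq0.
  by rewrite /root fE // theta'E invrK -theta'E [theta' + _]addrC (rootP galpha) mulr0.
have intrK_inj : injective (intr : int -> K).
  move=> a b ab; apply: (@intr_inj rat); apply: (fmorph_inj (in_alg K)).
  by rewrite !rmorph_int.
(* Evaluating f(y) = y^n g(y + 1/y) at 1 and -1 moves the squarefree hypothesis to g(2) g(-2). *)
have fE1 : f.[1] = g.[2].
  apply: intrK_inj; rewrite -!horner_map /= rmorph1 fE ?oner_eq0 //.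
  by rewrite expr1n mul1r invr1 rmorph_nat.
have fEN1 : f.[-1] = (-1) ^+ n * g.[-2].
  apply: intrK_inj; rewrite rmorphM -!horner_map rmorphXn rmorphN1 /= fE ?oppr_eq0 ?oner_eq0 //.
  by congr (_ * _.[_]); rewrite invrN1 rmorphN rmorph_nat -opprD.
have g_sqfree : squarefreez (g.[2] * g.[-2]).
  apply: squarefreez_dvd f_sqfree; rewrite fE1 fEN1.
  by apply/dvdzP; exists ((-1) ^+ n); ring.
have Dtheta : (theta - theta') ^+ 2 = alpha ^+ 2 - 4.
  have -> : 4 = 4 * (theta * theta') by rewrite theta_inv mulr1.
  by rewrite /alpha; ring.
have D_neq0 : alpha ^+ 2 - 4 != 0.
  (* Otherwise theta = 1 or theta = -1 would be a root of [f], making the squarefree product 0. *)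
  rewrite -Dtheta expf_eq0 /= subr_eq0 theta'E; apply/eqP => tt.
  have : theta ^+ 2 == 1 by rewrite expr2 {2}tt divff.
  have f0' := squarefreez_neq0 f_sqfree.
  rewrite sqrf_eq1 => /orP[] /eqP t1; move: ftheta; rewrite t1 /root.
    rewrite -(rmorph1 intr) horner_map /= -(rmorph0 intr) (inj_eq intrK_inj).
    by move/eqP=> e; move: f0'; rewrite e mulr0.
  rewrite -(rmorphN1 intr) horner_map /= -(rmorph0 intr) (inj_eq intrK_inj).
  by move/eqP=> e; move: f0'; rewrite e mul0r.
pose ev (U : {poly rat}) := map_poly (in_alg K) U.
have [h xE] : exists h, x = (ev h).[theta].
  have : x \in <<1; theta>>%VS by rewrite genK memvf.
  case/Fadjoin_polyP => p /polyOver1P[h ->] ->.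
  by exists h.
move=> ix.
have ftQ y : root (map_poly intr f) y -> root (map_poly (in_alg K) (map_poly intr f)) y.
  by rewrite map_in_alg_intr.
(* x' = h(1/theta) is the conjugate of x over Q(alpha). *)
set x' := (ev h).[theta'].
have ix' : integralOver (intr : int -> K) x'.
  by apply: (integralOver_conj f_irr (ftQ _ ftheta) (ftQ _ ftheta')); rewrite -/(ev h) -xE.
have itheta' : integralOver (intr : int -> K) theta' by exists f.
have [U [V UV]] := horner_decomp_add_inv (in_alg K) h.
set u := (ev U).[alpha]; set v := (ev V).[alpha].
have {}xE : x = u + v * theta by rewrite xE (UV _ _ theta_inv).
(* Swapping theta and theta' fixes alpha, hence the same [u] and [v]. *)
have x'E : x' = u + v * theta' by rewrite /x' (UV _ theta) ?[theta' + _]addrC // mulrC.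
have int_alpha (P : {poly rat}) := @monogenic_integral g K alpha P g_monogenic galpha.
pose D : {poly int} := 'X^2 - 4%:P.
have DE : (map_poly intr D).[alpha] = alpha ^+ 2 - 4.
  by rewrite rmorphB /= map_polyXn map_polyC !hornerE.
have [W WE] : exists W : {poly int}, v * (alpha ^+ 2 - 4) = (map_poly intr W).[alpha].
  have E : (ev (V * map_poly intr D)).[alpha] = v * (alpha ^+ 2 - 4).
    by rewrite /ev rmorphM hornerM /= map_in_alg_intr DE.
  rewrite -E; apply: int_alpha; rewrite -/(ev _) E -Dtheta.
  have -> : v * (theta - theta') ^+ 2 = (x - x') * (theta - theta') by rewrite xE x'E; ring.
  by apply: integral_mul; apply: integral_sub.
have [C CE] : exists C : {poly int}, v ^+ 2 * (alpha ^+ 2 - 4) = (map_poly intr C).[alpha].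
  have E : (ev (V ^+ 2 * map_poly intr D)).[alpha] = v ^+ 2 * (alpha ^+ 2 - 4).
    by rewrite /ev rmorphM rmorphXn hornerM horner_exp /= map_in_alg_intr DE.
  rewrite -E; apply: int_alpha; rewrite -/(ev _) E -Dtheta.
  have -> : v ^+ 2 * (theta - theta') ^+ 2 = (x - x') * (x - x') by rewrite xE x'E; ring.
  by apply: integral_mul; apply: integral_sub.
(* The identity (v D)^2 = D (v^2 D) at alpha is lifted to a congruence modulo [g] between integer
   polynomials. *)
have [H HE] : exists H, W ^+ 2 - D * C = g * H.
  apply: (monic_root_dvd g_monic g_irr galpha).
  rewrite /root rmorphB rmorphXn rmorphM hornerD hornerN /= horner_exp hornerM DE -WE -CE.
  by apply/eqP; ring.
have [P [R WR]] : exists P R : {poly int}, W = D * R + g * P.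
  by apply: (@reduced_mod_X2sub4 g W C H g_sqfree); rewrite -HE addrC subrK.
have vE : v = (map_poly intr R).[alpha].
  apply: (mulIf D_neq0).
  by rewrite WE WR rmorphD !rmorphM /= hornerD !hornerM DE (rootP galpha) mul0r addr0 mulrC.
have [Q uE] : exists Q : {poly int}, u = (map_poly intr Q).[alpha].
  apply: int_alpha; rewrite -/(ev _) -/u.
  have -> : u = x - v * theta by rewrite xE addrK.
  apply: integral_sub => //; apply: integral_mul => //.
  rewrite vE; apply: integral_horner; last exact: integral_add.
  by move=> _ /(nthP 0)[i _ <-]; rewrite coef_map; apply: integral_id.
(* Composition with X - fq turns integer polynomials in alpha into integer polynomials in theta. *)
have alphaE : alpha = (map_poly intr ('X - fq)).[theta].
  by rewrite rmorphB /= map_polyX !hornerE /alpha /theta' rmorphN hornerN.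
exists ((Q \Po ('X - fq)) + (R \Po ('X - fq)) * 'X).
rewrite rmorphD rmorphM /= !map_comp_poly map_polyX !hornerE /= !horner_comp -alphaE.
by rewrite xE uE vE.
Qed.
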